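(* Let $V$ be a real vector space with $\dim V=n$, and let a convex body $K\subset V$ be covered by planks $P_1,\dots,P_N$. Let $\|\cdot\|$ be the norm on $V$ with unit ball $K-K$, let $\|\cdot\|_*$ be the dual norm on $V^*$, and let $w(P_i)$ denote the width of $P_i$ in the norm $\|\cdot\|$. Assume that unit normals (with respect to $\|\cdot\|_*$) $n_1,\dots,n_N\in V^*$ to the planks $P_1,\dots,P_N$ can be chosen so that for every sequence of non-negative coefficients $c_1,\dots,c_N$, at least one of which equals $1$, $$\Big\|\sum_{i=1}^N c_i n_i\Big\|_*\ge 1 .$$ Then $$\sum_{i=1}^N w(P_i)\ \ge\ \frac{n+1}{2n}.$$
   Context: A convex body is a compact convex set with nonempty interior; $K-K=\{x-y:x,y\in K\}$. A plank in $V$ is a closed region between a pair of parallel hyperplanes; its width is the distance between these hyperplanes in the norm $\|\cdot\|$. A unit normal of a plank $P$ is an element $n\in V^*$ with $\|n\|_*=1$ such that the bounding hyperplanes of $P$ have the form $\{x\in V:\langle n,x\rangle=\mathrm{const}\}$ (each plank has exactly two unit normals, $\pm n$). *)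

(* Defs.v *)
From HB Require Import structures.
From mathcomp Require Import all_boot all_order all_algebra.
From mathcomp Require Import all_classical all_reals all_analysis.
Import Order.TTheory GRing.Theory Num.Theory.
Import numFieldNormedType.Exports.

Set Implicit Arguments.
Unset Strict Implicit.
Unset Printing Implicit Defensive.

Local Open Scope classical_set_scope.
Local Open Scope ring_scope.

(* A vectType carries no topology in the library. The usual topology of a
   finite-dimensional real vector space is the one transported from row vectors
   by coordinates in a basis; it does not depend on the basis. *)
Definition coords (R : realType) (V : vectType R) : V -> 'rV[R]_(\dim {:V}) :=
  passmx.rVof (vbasis {:V}).

Definition convex_body (R : realType) (V : vectType R) (K : set V) : Prop :=
  [/\ convex_set K, compact (@coords R V @` K)
    & interior (@coords R V @` K) !=set0].

Definition diff_body (R : realType) (V : vectType R) (K : set V) : set V :=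
  [set x - y | x in K & y in K].

Definition is_norm (R : realType) (V : vectType R) (nm : V -> R) : Prop :=
  [/\ forall x y, nm (x + y) <= nm x + nm y,
      forall (a : R) x, nm (a *: x) = `|a| * nm x
    & forall x, nm x = 0 -> x = 0].

Definition norm_with_unit_ball (R : realType) (V : vectType R) (nm : V -> R)
    (B : set V) : Prop :=
  is_norm nm /\ [set x | nm x <= 1] = B.

Definition dual_space (R : realType) (V : vectType R) := 'Hom(V, R^o).

Definition dual_norm (R : realType) (V : vectType R) (nm : V -> R)
    (f : dual_space V) : R :=
  sup [set `|f x : R| | x in [set x | nm x <= 1]].

Definition level_set (R : realType) (V : vectType R) (f : dual_space V) (c : R) :
  set V := [set x | (f x : R) = c].

(* The two hyperplanes are allowed to coincide (a plank of width zero). *)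
Record plank (R : realType) (V : vectType R) := Plank {
  plank_fun : dual_space V;
  plank_lo : R;
  plank_hi : R;
  plank_fun_neq0 : plank_fun != 0;
  plank_le : plank_lo <= plank_hi }.

Definition plank_set (R : realType) (V : vectType R) (P : plank V) : set V :=
  [set x | plank_lo P <= (plank_fun P x : R) <= plank_hi P].

Definition plank_hyperplane_lo (R : realType) (V : vectType R) (P : plank V) :=
  level_set (plank_fun P) (plank_lo P).

Definition plank_hyperplane_hi (R : realType) (V : vectType R) (P : plank V) :=
  level_set (plank_fun P) (plank_hi P).

Definition set_dist (R : realType) (V : vectType R) (nm : V -> R)
    (A B : set V) : R :=
  inf [set nm (x - y) | x in A & y in B].

Definition plank_width (R : realType) (V : vectType R) (nm : V -> R)
    (P : plank V) : R :=
  set_dist nm (plank_hyperplane_lo P) (plank_hyperplane_hi P).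

Definition unit_normal (R : realType) (V : vectType R) (nm : V -> R)
    (P : plank V) (m : dual_space V) : Prop :=
  [/\ dual_norm nm m = 1,
      exists c, plank_hyperplane_lo P = level_set m c
    & exists c, plank_hyperplane_hi P = level_set m c].

(* Main.v *)
Require Import Defs.
From HB Require Import structures.
From mathcomp Require Import all_boot all_order all_algebra.
From mathcomp Require Import all_classical all_reals all_analysis.
From mathcomp Require Import ring lra.
Import Order.TTheory GRing.Theory Num.Theory.
Import numFieldNormedType.Exports.

Set Implicit Arguments.
Unset Strict Implicit.
Unset Printing Implicit Defensive.

Local Open Scope classical_set_scope.
Local Open Scope ring_scope.

(** The proof gives the stronger bound 1 for the sum of the widths, which
    dominates (n + 1) / (2 n) for n >= 1.

    Let B = K - K be the unit ball.  The hypothesis on non-negative combinations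
    says that, for each i, the convex set of functionals m_i + sum_(j != i) c_j m_j
    with c >= 0 misses the open dual unit ball.  By duality
    ([exists_increasing_pair]) there are a_i, b_i in K such that the vector
    v_i = a_i - b_i satisfies m_i(v_i) >= 1 and m_j(v_i) >= 0 for all j: moving
    along v_i crosses plank i at unit speed and never moves backwards with respect
    to any of the other planks.

    Suppose the widths sum to less than 1, and enlarge them to weights w_i with
    sum 1.  All the points x_S = sum_i w_i p_i, where p_i = a_i for i in S and
    p_i = b_i otherwise, are convex combinations of points of K.  Adding i to S
    translates x_S by w_i v_i, so a point lying in plank i is carried strictly
    above it, while every plank it was already above remains below it.  Hence a
    maximal S such that x_S is above all the planks of S gives a point of K outside
    every plank ([exists_point_off_planks]), which contradicts the covering.

    The remaining ingredient, [unit_normal_plank], bounds below the width of a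
    plank in the norm by the length of the interval of values that its unit normal
    takes on it. *)

(** * Convex combinations and linear functionals *)

Lemma convex_set_comb (R : realType) (V : vectType R) (K : set V) (x y : V) (t : R) :
  convex_set K -> K x -> K y -> 0 <= t <= 1 -> K (t *: x + (1 - t) *: y).
Proof.
move=> cK Kx Ky t01.
have tP : Itv.spec (@Itv.num_sem R) (Itv.Real `[0%Z, 1%Z]) t.
  by rewrite /= /Itv.num_sem /= in_itv /= ger0_real //; case/andP: t01.
have := cK x y (Itv.mk tP); rewrite !inE; exact.
Qed.

Lemma convex_set_sum (R : realType) (V : vectType R) (K : set V) (N : nat)
    (w : 'I_N -> R) (p : 'I_N -> V) :
  convex_set K -> (forall i, K (p i)) -> (forall i, 0 <= w i) ->
  \sum_i w i = 1 -> K (\sum_i w i *: p i).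
Proof.
move=> cK Kp w0 w1.
(* Partial sums of the weights are not 1, so the induction normalises them. *)
suff /(_ (index_enum 'I_N)) : forall r : seq 'I_N, 0 < \sum_(i <- r) w i ->
    K ((\sum_(i <- r) w i)^-1 *: \sum_(i <- r) w i *: p i).
  by rewrite w1 invr1 scale1r; apply.
elim=> [|i r IH]; first by rewrite big_nil ltxx.
rewrite !big_cons; set s := \sum_(j <- r) w j; set S := \sum_(j <- r) w j *: p j.
move=> s0; have : 0 <= s by exact: sumr_ge0.
rewrite le_eqVlt => /predU1P[/esym sE|sgt0].
  have -> : S = 0.
    rewrite /S big_seq big1 // => j jr; have : w j <= s.
      rewrite /s (big_rem j) //= lerDl; exact: sumr_ge0.
    by rewrite sE => wj; rewrite (@le_anti _ _ (w j) 0) ?scale0r // wj w0.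
  rewrite sE !addr0 scalerA mulVf ?scale1r //.
  by move: s0; rewrite sE addr0 => /gt_eqF ->.
have -> : (w i + s)^-1 *: (w i *: p i + S) =
    (w i / (w i + s)) *: p i + (1 - w i / (w i + s)) *: (s^-1 *: S).
  rewrite scalerDr !scalerA; congr (_ *: _ + _ *: _); first by rewrite mulrC.
  by field; rewrite !gt_eqF.
apply: convex_set_comb => //; first exact: IH.
by rewrite divr_ge0 ?(ltW s0) //= ler_pdivrMr // mul1r lerDl ltW.
Qed.

Lemma dualZ (R : realType) (V : vectType R) (f : dual_space V) (a : R) x :
  (f (a *: x) : R) = a * (f x : R).
Proof. exact: linearZ. Qed.

(** [f] read in coordinates, where the topology lives. *)
Definition coord_fun (R : realType) (V : vectType R) (f : dual_space V)
    (s : 'rV[R]_(\dim {:V})) : R :=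
  \sum_k s 0 k * (f (vbasis {:V})`_k : R).

Lemma coord_funE (R : realType) (V : vectType R) (f : dual_space V) x :
  (f x : R) = coord_fun f (coords x).
Proof.
rewrite {1}(coord_vbasis (memvf x)) linear_sum /=; apply: eq_bigr => k _.
by rewrite linearZ /= /coords mxE.
Qed.

Lemma continuous_coord_fun (R : realType) (V : vectType R) (f : dual_space V) :
  continuous (coord_fun f).
Proof.
apply: continuous_big => [|k _]; first exact: add_continuous.
have ck : continuous (fun s : 'rV[R]_(\dim {:V}) => s 0 k).
  exact: coord_continuous.
by move=> s; exact: (cvgM (ck s) (cvg_cst _)).
Qed.

(** * Extracting directions from the condition on the normals *)

(** Replaces differentiation of max(0, s)^2: the right-hand side is its expansion
    max(0, s)^2 - 2 c max(0, s) to first order in c, with error c^2. *)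
Lemma ler_sq_max0 (R : realType) (s c : R) :
  Num.max 0 (s - c) ^+ 2 <= (Num.max 0 s - c) ^+ 2.
Proof.
have [?|?] := leP 0 (s - c); have [?|?] := leP 0 s; nra.
Qed.

(** A separation theorem for the cone of non-negative vectors, with e_i the i-th
    basis vector of the space of families of N reals.  Minimise over v in K - K the squared norm of the
    residual c, where c_j = max(0, e_i(j) - m_j(v)).  At a minimiser, first-order
    optimality says that sum_j c_j m_j attains its maximum over K - K at v, and the
    value there is c_i - sum_j c_j^2.  If c_i = 0, this must be at least the value
    at 0; otherwise, dividing by c_i, the hypothesis bounds it below by c_i.  In
    both cases c = 0, which is the claim. *)
Lemma exists_increasing_pair (R : realType) (V : vectType R) (K : set V) (N : nat)
    (m : 'I_N -> dual_space V) (i : 'I_N) :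
  convex_set K -> compact (@coords R V @` K) -> K !=set0 ->
  (forall c : 'I_N -> R, (forall j, 0 <= c j) -> c i = 1 ->
    forall M : R,
      (forall x y, K x -> K y -> \sum_j c j * (m j (x - y) : R) <= M) ->
      1 <= M) ->
  exists p : V * V, [/\ K p.1, K p.2, 1 <= (m i (p.1 - p.2) : R) &
    forall j, 0 <= (m j (p.1 - p.2) : R)].
Proof.
move=> cK kK [x0 Kx0] hm.
pose e (j : 'I_N) : R := (j == i)%:R.
pose res (j : 'I_N) (v : V) : R := Num.max 0 (e j - (m j v : R)).
pose G (p : 'rV[R]_(\dim {:V}) * 'rV[R]_(\dim {:V})) : R :=
  \sum_j Num.max 0 (e j - (coord_fun (m j) p.1 - coord_fun (m j) p.2)) ^+ 2.
have GE x y : G (coords x, coords y) = \sum_j res j (x - y) ^+ 2.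
  by apply: eq_bigr => j _; rewrite /res (linearB (m j)) /= !coord_funE.
have cG : continuous G.
  apply: continuous_big => [|j _ p]; first exact: add_continuous.
  have cmax : {for p, continuous (fun p : 'rV[R]_(\dim {:V}) * 'rV[R]_(\dim {:V}) =>
      Num.max 0 (e j - (coord_fun (m j) p.1 - coord_fun (m j) p.2)))}.
    apply: (@continuous_max R _ (fun=> 0)); first exact: cvg_cst.
    apply: cvgB; first exact: cvg_cst.
    apply: cvgB; (apply: continuous_comp; last exact: continuous_coord_fun).
      exact: cvg_fst.
    exact: cvg_snd.
  exact: (cvgM cmax cmax).
have [] := compact_EVT_min _ (compact_setX kK kK) (continuous_subspaceT cG).
  by exists (coords x0, coords x0); split; exists x0.
move=> [cx cy]; rewrite inE => -[/= [x Kx <-] [y Ky <-]] Gmin.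
pose v := x - y; pose c j := res j v.
have c0 j : 0 <= c j by rewrite /c /res le_max lexx.
have min_res x' y' : K x' -> K y' -> \sum_j c j ^+ 2 <= \sum_j res j (x' - y') ^+ 2.
  move=> Kx' Ky'; rewrite -!GE; apply: Gmin; rewrite inE.
  by split; [exists x'|exists y'].
have cv_max x' y' : K x' -> K y' ->
    \sum_j c j * (m j (x' - y') : R) <= \sum_j c j * (m j v : R).
  move=> Kx' Ky'; pose d (j : 'I_N) : R := m j (x' - y' - v).
  rewrite -subr_le0 -sumrB (eq_bigr (fun j => c j * d j)); last first.
    by move=> j _; rewrite -mulrBr -(linearB (m j)).
  set D := \sum_j _; pose Q := \sum_j d j ^+ 2.
  have Q0 : 0 <= Q by apply: sumr_ge0 => j _; exact: sqr_ge0.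
  (* Minimality of v compared with the points of the segment towards x' - y'. *)
  have step t : 0 <= t <= 1 -> 2 * t * D <= t ^+ 2 * Q.
    move=> t01.
    have := min_res _ _ (convex_set_comb cK Kx' Kx t01) (convex_set_comb cK Ky' Ky t01).
    move=> /le_trans -/(_ (\sum_j (c j - t * d j) ^+ 2)) H.
    have {H} : \sum_j c j ^+ 2 <= \sum_j (c j - t * d j) ^+ 2.
      apply: H; apply: ler_sum => j _.
      have -> : t *: x' + (1 - t) *: x - (t *: y' + (1 - t) *: y) =
          v + t *: (x' - y' - v).
        have tE (a b : V) : t *: a + (1 - t) *: b = b + t *: (a - b).
          by rewrite scalerBl scale1r scalerBr addrCA.
        rewrite !tE opprD addrACA -scalerBr /v !opprB [y - y']addrC addrACA.
        by rewrite [- x + y]addrC.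
      rewrite /res (linearD (m j)) /= dualZ opprD addrA; exact: ler_sq_max0.
    have -> : \sum_j (c j - t * d j) ^+ 2 =
        \sum_j c j ^+ 2 - 2 * t * D + t ^+ 2 * Q.
      rewrite /D /Q !mulr_sumr -sumrB -big_split /=.
      by apply: eq_bigr => j _; ring.
    lra.
  rewrite leNgt; apply/negP => D0.
  (* If D > 0, the parameter t = D / (Q + D) violates 2 D <= t Q. *)
  have QD : 0 < Q + D by lra.
  have := step (D / (Q + D)).
  rewrite divr_ge0 ?(ltW D0) ?(ltW QD) //= ler_pdivrMr // mul1r lerDr => /(_ Q0).
  have -> : 2 * (D / (Q + D)) * D = D ^+ 2 / (Q + D) ^+ 2 * (2 * (Q + D)).
    by field; rewrite gt_eqF.
  rewrite expr_div_n ler_pM2l; last by rewrite divr_gt0 // exprn_gt0.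
  lra.
have cvE : \sum_j c j * (m j v : R) = c i - \sum_j c j ^+ 2.
  rewrite (bigD1 i) //= [X in _ = _ - X](bigD1 i) //= opprD addrA -sumrN.
  have cE j : c j * (m j v : R) = c j * e j - c j ^+ 2.
    by rewrite /c /res; case: leP => ?; ring.
  rewrite cE /e eqxx mulr1; congr (_ + _).
  by apply: eq_bigr => j /negbTE ji; rewrite cE /e ji mulr0 sub0r.
have sq0 j : c j ^+ 2 <= \sum_j c j ^+ 2.
  by rewrite (bigD1 j) //= lerDl sumr_ge0 // => k _; exact: sqr_ge0.
have sum_le0 : \sum_j c j ^+ 2 <= 0.
  have := c0 i; rewrite le_eqVlt => /predU1P[ci0|ci0].
    have := cv_max _ _ Kx0 Kx0.
    rewrite cvE -ci0 subrr big1 ?sub0r ?oppr_ge0 // => j _.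
    by rewrite (linear0 (m j)) mulr0.
  have := hm (fun j => (c i)^-1 * c j) _ _ (1 - (c i)^-1 * \sum_j c j ^+ 2).
  rewrite mulVf ?gt_eqF //.
  have ge0 j : 0 <= (c i)^-1 * c j by rewrite mulr_ge0 ?invr_ge0.
  move=> /(_ ge0 erefl) H.
  have {H} : 1 <= 1 - (c i)^-1 * \sum_j c j ^+ 2.
    apply: H => x' y' Kx' Ky'.
    have -> : 1 - (c i)^-1 * \sum_j c j ^+ 2 =
        (c i)^-1 * \sum_j c j * (m j v : R).
      by rewrite cvE mulrBr mulVf // gt_eqF.
    under eq_bigr do rewrite -mulrA.
    by rewrite -mulr_sumr ler_pM2l ?invr_gt0 // cv_max.
  by rewrite lerBrDl -lerBrDr subrr pmulr_rle0 ?invr_gt0.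
have cj0 j : c j = 0.
  by apply/eqP; rewrite -sqrf_eq0 eq_le sqr_ge0 (le_trans (sq0 j)).
have mge j : e j <= (m j v : R).
  by rewrite -subr_le0 -(cj0 j) /c /res le_max lexx orbT.
exists (x, y); split => // [|j]; first by have := mge i; rewrite /e eqxx.
by apply: le_trans (mge j); rewrite ler0n.
Qed.

(** * Planks and their unit normals *)

Lemma is_norm_ge0 (R : realType) (V : vectType R) (nm : V -> R) x :
  is_norm nm -> 0 <= nm x.
Proof.
case=> nmD nmZ _.
have nm0 : nm 0 = 0 by rewrite -(scale0r (0 : V)) nmZ normr0 mul0r.
have nmN : nm (- x) = nm x by rewrite -scaleN1r nmZ normrN1 mul1r.
by have := nmD x (- x); rewrite subrr nm0 nmN; lra.
Qed.

Lemma le_unit_dual_norm (R : realType) (V : vectType R) (nm : V -> R)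
    (m : dual_space V) x :
  is_norm nm -> dual_norm nm m = 1 -> `|m x : R| <= nm x.
Proof.
move=> nmP m1; case: (nmP) => _ nmZ nm0.
have [nmx0|nmx0] := eqVneq (nm x) 0.
  by rewrite nmx0 (nm0 _ nmx0) (linear0 m) normr0.
have nmx_gt0 : 0 < nm x by rewrite lt_neqAle eq_sym nmx0 is_norm_ge0.
(* The supremum of an unbounded set is 0 by convention, so the value 1 already
   forces the set to be bounded. *)
have [_ ubS] : has_sup [set `|m x : R| | x in [set x | nm x <= 1]].
  apply: contrapT => /sup_out m0.
  by move/eqP: m1; rewrite /dual_norm m0 eq_sym oner_eq0.
have : `|m ((nm x)^-1 *: x) : R| <= 1.
  rewrite -m1; apply: (ub_le_sup ubS); exists ((nm x)^-1 *: x) => //=.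
  by rewrite nmZ gtr0_norm ?invr_gt0 // mulVf.
by rewrite dualZ normrM gtr0_norm ?invr_gt0 // mulrC ler_pdivrMr // mul1r.
Qed.

(** Since one bounding hyperplane is a level set of both functionals, m is a
    multiple lam of the functional f defining the plank, so the interval
    that m sees is the interval of f scaled by lam.  Two points on the two bounding
    hyperplanes differ under m by exactly its length, and |m| <= nm. *)
Lemma unit_normal_plank (R : realType) (V : vectType R) (nm : V -> R)
    (P : plank V) (m : dual_space V) :
  is_norm nm -> unit_normal nm P m ->
  exists I : R * R, [/\ I.1 <= I.2, I.2 - I.1 <= plank_width nm P &
    forall x, plank_set P x -> I.1 <= (m x : R) <= I.2].
Proof.
move=> nmP [m1 [c loE] _]; have f0 := plank_fun_neq0 P; have lohi := plank_le P.
rewrite /plank_width /plank_set /plank_hyperplane_hi; move: loE.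
rewrite /plank_hyperplane_lo.
move: (plank_fun P) (plank_lo P) (plank_hi P) f0 lohi => f lo hi f0 lohi loE.
have [z fz] : exists z, (f z : R) = 1.
  have [z0 fz0] : exists z, (f z : R) != 0.
    apply: contrapT => f_eq0; move/eqP: f0; apply; apply/lfunP => z.
    rewrite zero_lfunE; apply/eqP; apply: contrapT => fz.
    by apply: f_eq0; exists z; apply/negP.
  by exists ((f z0 : R)^-1 *: z0); rewrite dualZ mulVf.
pose lam : R := m z.
(* For u in ker f, the points lo z and lo z + u lie on the same level set of m, so
   m vanishes on ker f; apply this to u = x - f(x) z. *)
have mE x : (m x : R) = lam * (f x : R).
  have fc u : (f u : R) = lo -> (m u : R) = c.
    by move=> fu; have : level_set f lo u by []; rewrite [level_set f lo]loE.
  have m_lo : (m (lo *: z) : R) = c by apply: fc; rewrite dualZ fz mulr1.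
  have : (m (lo *: z + (x - (f x : R) *: z)) : R) = c.
    apply: fc; rewrite (linearD f) /= (linearB f) /= !dualZ fz !mulr1.
    by rewrite subrr addr0.
  rewrite (linearD m) /= m_lo (linearB m) /= dualZ => /eqP.
  by rewrite -subr_eq0 addrAC subrr add0r subr_eq0 => /eqP ->; rewrite mulrC.
have width_ge : `|lam| * (hi - lo) <= set_dist nm (level_set f lo) (level_set f hi).
  apply: lb_le_inf.
    exists (nm (lo *: z - hi *: z)), (lo *: z).
      by rewrite /level_set /= dualZ fz mulr1.
    by exists (hi *: z) => //; rewrite /level_set /= dualZ fz mulr1.
  move=> _ [x fx] [y fy] <-; apply: le_trans (le_unit_dual_norm _ nmP m1).
  by rewrite mE normrM (linearB f) /= fx fy distrC [`|hi - lo|]ger0_norm ?subr_ge0.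
have [lam0|lam0] := leP 0 lam.
  exists (lam * lo, lam * hi); split => [||x /= /andP[lox xhi]] /=.
  - exact: ler_wpM2l.
  - by rewrite -mulrBr -[lam in lam * _](ger0_norm lam0).
  - by rewrite mE !ler_wpM2l.
exists (lam * hi, lam * lo); split => [||x /= /andP[lox xhi]] /=.
- by rewrite ler_nM2l.
- by rewrite -mulrBr -opprB mulrN -mulNr -(ltr0_norm lam0).
- by rewrite mE !ler_nM2l // xhi.
Qed.

(** * A point of the body outside all the planks *)

(** A counterpart of Bang's lemma in which the matrix m_j(a_i - b_i) has
    non-negative entries, so that a maximal set of indices replaces the
    maximisation of a quadratic form. *)
Lemma exists_point_off_planks (R : realType) (V : vectType R) (K : set V)
    (N : nat) (m : 'I_N -> dual_space V) (p : 'I_N -> V * V)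
    (w lo hi : 'I_N -> R) :
  convex_set K -> (forall i, K (p i).1 /\ K (p i).2) ->
  (forall i, 1 <= (m i ((p i).1 - (p i).2) : R)) ->
  (forall i j, 0 <= (m j ((p i).1 - (p i).2) : R)) ->
  (forall i, 0 <= w i) -> \sum_i w i = 1 -> (forall i, hi i - lo i < w i) ->
  exists2 x, K x & forall i, ~~ (lo i <= (m i x : R) <= hi i).
Proof.
move=> cK Kp mi mj w0 w1 lohi.
pose pt (S : {set 'I_N}) := \sum_i w i *: (if i \in S then (p i).1 else (p i).2).
pose above (S : {set 'I_N}) := [forall i in S, hi i < (m i (pt S) : R)].
have above0 : above finset.set0 by apply/forall_inP => i; rewrite finset.in_set0.
have [S /maxsetP[/forall_inP aboveS maxS] _] := maxset_exists above0.
exists (pt S) => [|i].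
  by apply: convex_set_sum => // i; case: ifP => _; case: (Kp i).
apply/negP => /andP[lo_pt pt_hi].
have iS : i \notin S.
  by apply/negP => /aboveS /lt_le_trans /(_ pt_hi); rewrite ltxx.
have ptU : pt (i |: S)%SET = pt S + w i *: ((p i).1 - (p i).2).
  rewrite /pt (bigD1 i) //= [in RHS](bigD1 i) //= setU11 (negbTE iS) addrAC.
  rewrite -scalerDr subrKC; congr (_ + _); apply: eq_bigr => j /negbTE ji.
  by rewrite in_setU1 ji.
have : (i |: S)%SET = S.
  apply: maxS; last exact: subsetU1.
  apply/forall_inP => j; rewrite ptU (linearD (m j)) /= dualZ.
  rewrite in_setU1 => /predU1P[->|/aboveS hj].
    have : w i <= w i * (m i ((p i).1 - (p i).2) : R) by rewrite ler_peMr.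
    have := lohi i; lra.
  by rewrite ltr_wpDr // mulr_ge0.
by move=> US; move: iS; rewrite -US setU11.
Qed.

Lemma sum_plank_width_ge1 (R : realType) (V : vectType R) (K : set V) (N : nat)
    (P : 'I_N -> plank V) (nm : V -> R) (m : 'I_N -> dual_space V) :
  convex_body K ->
  K `<=` \bigcup_(i in [set: 'I_N]) plank_set (P i) ->
  norm_with_unit_ball nm (diff_body K) ->
  (forall i : 'I_N, unit_normal nm (P i) (m i)) ->
  (forall c : 'I_N -> R, (forall i, 0 <= c i) -> (exists i, c i = 1) ->
     1 <= dual_norm nm (\sum_(i < N) c i *: m i)) ->
  1 <= \sum_(i < N) plank_width nm (P i).
Proof.
move=> [cK kK [s /interior_subset[x0 Kx0 _]]] cover [nmP ballE] normals hm.
have /choice[p pP] i : exists p : V * V, [/\ K p.1, K p.2,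
    1 <= (m i (p.1 - p.2) : R) & forall j, 0 <= (m j (p.1 - p.2) : R)].
  apply: exists_increasing_pair => // [|c c0 ci M le_M]; first by exists x0.
  apply: le_trans (hm c c0 _) _; first by exists i.
  have sumE x : ((\sum_j c j *: m j) x : R) = \sum_j c j * (m j x : R).
    by rewrite sum_lfunE; apply: eq_bigr => j _; rewrite scale_lfunE.
  rewrite /dual_norm ballE; apply: ge_sup.
    exists `|(\sum_j c j *: m j) (x0 - x0) : R|, (x0 - x0) => //.
    by exists x0 => //; exists x0.
  move=> _ [_ [x Kx [y Ky <-]] <-]; rewrite ler_norml lerNl.
  by rewrite -(linearN (\sum_j c j *: m j)) /= opprB !sumE !le_M.
have /choice[I IP] i := unit_normal_plank nmP (normals i).
rewrite leNgt; apply/negP => sum_lt1.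
have N_gt0 : (0 < N)%N.
  by have [i _ _] := cover _ Kx0; apply: leq_trans (ltn_ord i).
(* The missing total width, shared equally, makes the weights sum to 1 and each of
   them strictly larger than the width it replaces. *)
pose slack := (1 - \sum_i plank_width nm (P i)) / N%:R.
have slack0 : 0 < slack by rewrite divr_gt0 ?subr_gt0 ?ltr0n.
have [||i|i j|i||i|x Kx offx] := @exists_point_off_planks _ _ K N m p
  (fun i => plank_width nm (P i) + slack) (fun i => (I i).1) (fun i => (I i).2).
- exact: cK.
- by move=> i; case: (pP i).
- by case: (pP i).
- by case: (pP i).
- by case: (IP i) => *; lra.
- rewrite big_split /= sumr_const card_ord -mulr_natr divfK ?pnatr_eq0 -?lt0n //.
  by rewrite subrKC.
- by case: (IP i) => *; lra.
have [i _ Pix] := cover _ Kx; have := offx i.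
by case: (IP i) => _ _ /(_ _ Pix) ->.
Qed.

Theorem corollary3p7 (R : realType) (V : vectType R) (n : nat)
    (dimV : \dim {:V} = n) (K : set V) (N : nat) (P : 'I_N -> plank V)
    (nm : V -> R) (m : 'I_N -> dual_space V) :
  convex_body K ->
  K `<=` \bigcup_(i in [set: 'I_N]) plank_set (P i) ->
  norm_with_unit_ball nm (diff_body K) ->
  (forall i : 'I_N, unit_normal nm (P i) (m i)) ->
  (forall c : 'I_N -> R, (forall i, 0 <= c i) -> (exists i, c i = 1) ->
     1 <= dual_norm nm (\sum_(i < N) c i *: m i)) ->
  (n%:R + 1) / (2 * n%:R) <= \sum_(i < N) plank_width nm (P i).
Proof.
move=> bodyK cover ball normals hm.
apply: le_trans (sum_plank_width_ge1 bodyK cover ball normals hm).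
(* For n = 0 the left-hand side is 1 / 0, that is 0. *)
case: n {dimV} => [|n]; first by rewrite mulr0 invr0 mulr0.
have : 1 <= n.+1%:R :> R by rewrite ler1n.
by move=> n1; rewrite ler_pdivrMr; lra.
Qed.
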